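(* Any tree $(T,\le)$ with $\omega$ levels, all finite, has a balanced subtree which has no leaves and also has $\omega$ levels.
   Context: The axiom of choice is not assumed (work in ZF, or in ZF with atoms). A tree here is a well-founded tree: a partially ordered set $(T,\le)$ with a least element (root) in which $\{y\in T:y\le x\}$ is well-ordered for every $x\in T$. Its levels are defined recursively: $L_\alpha$ is the set of minimal elements of $T\setminus\bigcup_{\beta<\alpha}L_\beta$; it has $\omega$ levels if $\omega$ is the least ordinal $\alpha$ with $L_\alpha=\emptyset$. A leaf is a maximal element. A subtree is a downwards closed subset under the induced ordering. $\mathrm{succ}(x)$ denotes the set of immediate successors of $x$. A finite-branching tree is balanced if for all vertices $x$ in the same level the sets $\mathrm{succ}(x)$ (computed in that tree) have equal cardinality. *)

(* Defs.v *)
(* Vanilla Rocq, no library.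

   Choice-free set theory is rendered by quantifying over all first-order
   models M of ZFA (ZF with a set of atoms, no axiom of choice) and reading the
   mathematical statement inside M: every quantifier over trees, subsets,
   functions, ordinals, ... ranges over elements of M.  By Goedel's completeness
   theorem, truth in all models is provability from the axioms.  Separation and
   Replacement are the first-order schemas: schemas over all Rocq predicates
   would import choice from the metatheory. *)

Set Implicit Arguments.
Unset Strict Implicit.

Record structure : Type := Structure {
  carrier :> Type;
  mem : carrier -> carrier -> Prop;
  atom : carrier -> Prop
}.

Arguments mem {s}.
Arguments atom {s}.

Notation "x ∈ y" := (mem x y) (at level 70, no associativity).

(* Formulas of the language {∈, =, atom}, with de Bruijn indices. *)
Inductive formula : Type :=
| f_mem (i j : nat)
| f_eq (i j : nat)
| f_atom (i : nat)
| f_false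
| f_imp (p q : formula)
| f_and (p q : formula)
| f_or (p q : formula)
| f_all (p : formula)
| f_ex (p : formula).

Definition scons {A : Type} (x : A) (e : nat -> A) (i : nat) : A :=
  match i with O => x | S j => e j end.

Fixpoint sat {M : structure} (e : nat -> M) (p : formula) : Prop :=
  match p with
  | f_mem i j => e i ∈ e j
  | f_eq i j => e i = e j
  | f_atom i => atom (e i)
  | f_false => False
  | f_imp p q => sat e p -> sat e q
  | f_and p q => sat e p /\ sat e q
  | f_or p q => sat e p \/ sat e q
  | f_all p => forall x : M, sat (scons x e) p
  | f_ex p => exists x : M, sat (scons x e) p
  end.

Definition is_set {M : structure} (x : M) : Prop := ~ atom x.

Definition is_empty {M : structure} (x : M) : Prop :=
  is_set x /\ forall y : M, ~ y ∈ x.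

Definition subset {M : structure} (x y : M) : Prop :=
  forall z : M, z ∈ x -> z ∈ y.

(* y = x ∪ {x} *)
Definition is_succ {M : structure} (y x : M) : Prop :=
  is_set y /\ forall z : M, z ∈ y <-> z ∈ x \/ z = x.

Definition inductive_set {M : structure} (i : M) : Prop :=
  (exists e : M, is_empty e /\ e ∈ i) /\
  (forall x : M, x ∈ i -> exists y : M, is_succ y x /\ y ∈ i).

(* The set of atoms may be empty; the models of ZF are exactly the models in
   which it is.  The environment e in the two schemas supplies the parameters. *)
Record models_ZFA (M : structure) : Prop := {
  zfa_atoms_no_member : forall a x : M, atom a -> ~ x ∈ a;
  zfa_atoms_set : exists A : M, is_set A /\ forall x : M, x ∈ A <-> atom x;
  zfa_extensionality : forall x y : M, is_set x -> is_set y ->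
    (forall z : M, z ∈ x <-> z ∈ y) -> x = y;
  zfa_foundation : forall x : M, (exists y : M, y ∈ x) ->
    exists y : M, y ∈ x /\ forall z : M, z ∈ y -> ~ z ∈ x;
  zfa_pairing : forall x y : M,
    exists p : M, is_set p /\ forall z : M, z ∈ p <-> z = x \/ z = y;
  zfa_union : forall x : M,
    exists u : M, is_set u /\
      forall z : M, z ∈ u <-> exists y : M, z ∈ y /\ y ∈ x;
  zfa_powerset : forall x : M,
    exists p : M, is_set p /\ forall z : M, z ∈ p <-> is_set z /\ subset z x;
  zfa_infinity : exists i : M, is_set i /\ inductive_set i;
  zfa_separation : forall (p : formula) (e : nat -> M) (x : M),
    exists y : M, is_set y /\
      forall z : M, z ∈ y <-> z ∈ x /\ sat (scons z e) p;
  zfa_replacement : forall (p : formula) (e : nat -> M) (x : M),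
    (forall u v v' : M, u ∈ x -> sat (scons u (scons v e)) p ->
       sat (scons u (scons v' e)) p -> v = v') ->
    exists y : M, is_set y /\
      forall v : M, v ∈ y <->
        exists u : M, u ∈ x /\ sat (scons u (scons v e)) p
}.

(* Ordered pairs (Kuratowski), functions, ordinals *)

Definition is_upair {M : structure} (p x y : M) : Prop :=
  is_set p /\ forall z : M, z ∈ p <-> z = x \/ z = y.

Definition is_opair {M : structure} (p x y : M) : Prop :=
  exists s d : M, is_upair s x x /\ is_upair d x y /\ is_upair p s d.

Definition related {M : structure} (r x y : M) : Prop :=
  exists p : M, is_opair p x y /\ p ∈ r.

Definition function_on {M : structure} (f d : M) : Prop :=
  is_set f /\
  (forall p : M, p ∈ f -> exists x y : M, x ∈ d /\ is_opair p x y) /\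
  (forall x : M, x ∈ d -> exists! y : M, related f x y).

Definition bijection {M : structure} (f a b : M) : Prop :=
  function_on f a /\
  (forall x y : M, related f x y -> y ∈ b) /\
  (forall x x' y : M, related f x y -> related f x' y -> x = x') /\
  (forall y : M, y ∈ b -> exists x : M, related f x y).

Definition equinumerous {M : structure} (a b : M) : Prop :=
  exists f : M, bijection f a b.

Definition is_ordinal {M : structure} (a : M) : Prop :=
  is_set a /\
  (forall x : M, x ∈ a -> is_set x /\ subset x a) /\
  (forall x y z : M, x ∈ a -> y ∈ a -> z ∈ a -> x ∈ y -> y ∈ z -> x ∈ z) /\
  (forall x : M, x ∈ a -> ~ x ∈ x) /\
  (forall x y : M, x ∈ a -> y ∈ a -> x ∈ y \/ x = y \/ y ∈ x) /\
  (forall b : M, subset b a -> (exists x : M, x ∈ b) ->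
     exists m : M, m ∈ b /\ forall x : M, x ∈ b -> m = x \/ m ∈ x).

Definition is_omega {M : structure} (w : M) : Prop :=
  is_set w /\
  forall x : M, x ∈ w <-> forall i : M, inductive_set i -> x ∈ i.

Definition finite {M : structure} (a : M) : Prop :=
  exists w n : M, is_omega w /\ n ∈ w /\ equinumerous a n.

(* Trees.  A tree is a pair of elements of M: the set T and its order le, a set
   of ordered pairs. *)

Definition partial_order {M : structure} (T le : M) : Prop :=
  is_set T /\ is_set le /\
  (forall p : M, p ∈ le -> exists x y : M, x ∈ T /\ y ∈ T /\ is_opair p x y) /\
  (forall x : M, x ∈ T -> related le x x) /\
  (forall x y : M, related le x y -> related le y x -> x = y) /\
  (forall x y z : M, related le x y -> related le y z -> related le x z).

Definition is_tree {M : structure} (T le : M) : Prop :=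
  partial_order T le /\
  (exists r : M, r ∈ T /\ forall x : M, x ∈ T -> related le r x) /\
  (forall x : M, x ∈ T ->
     (forall y z : M, related le y x -> related le z x ->
        related le y z \/ related le z y) /\
     (forall b : M, (exists y : M, y ∈ b) ->
        (forall y : M, y ∈ b -> related le y x) ->
        exists m : M, m ∈ b /\ forall y : M, y ∈ b -> related le m y)).

Definition minimal {M : structure} (le : M) (P : M -> Prop) (x : M) : Prop :=
  P x /\ forall y : M, P y -> related le y x -> y = x.

(* L = L_a, where a is an ordinal: f is the sequence (L_b)_{b <= a} obtained by
   transfinite recursion, a function with domain a + 1. *)
Definition is_level {M : structure} (T le a L : M) : Prop :=
  is_ordinal a /\
  exists d f : M, is_succ d a /\ function_on f d /\
    (forall b X : M, related f b X ->
       is_set X /\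
       forall x : M, x ∈ X <->
         minimal le
           (fun y => y ∈ T /\ ~ exists c Y : M, c ∈ b /\ related f c Y /\ y ∈ Y)
           x) /\
    related f a L.

(* a is the least ordinal with empty level (b ∈ a says b < a). *)
Definition has_levels {M : structure} (T le a : M) : Prop :=
  (exists L : M, is_level T le a L /\ is_empty L) /\
  (forall b L : M, b ∈ a -> is_level T le b L -> ~ is_empty L).

Definition is_leaf {M : structure} (T le x : M) : Prop :=
  x ∈ T /\ forall y : M, y ∈ T -> related le x y -> y = x.

Definition is_subtree {M : structure} (S leS T le : M) : Prop :=
  is_set S /\ subset S T /\
  (forall x y : M, x ∈ S -> related le y x -> y ∈ S) /\
  is_set leS /\
  (forall p : M, p ∈ leS <->
     p ∈ le /\ exists x y : M, x ∈ S /\ y ∈ S /\ is_opair p x y).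

Definition immediate_succ {M : structure} (T le x y : M) : Prop :=
  y ∈ T /\ y <> x /\ related le x y /\
  forall z : M, related le x z -> related le z y -> z = x \/ z = y.

(* s = succ(x), computed in (T, le) *)
Definition is_succ_set {M : structure} (T le s x : M) : Prop :=
  is_set s /\ forall y : M, y ∈ s <-> immediate_succ T le x y.

Definition finite_branching {M : structure} (T le : M) : Prop :=
  forall x s : M, x ∈ T -> is_succ_set T le s x -> finite s.

Definition balanced {M : structure} (T le : M) : Prop :=
  is_tree T le /\ finite_branching T le /\
  forall a L x y s t : M, is_level T le a L -> x ∈ L -> y ∈ L ->
    is_succ_set T le s x -> is_succ_set T le t y -> equinumerous s t.

(* Main.v *)
Require Import Defs.
From Stdlib Require Import Classical Arith.

(** ** Idea of the proof

    A subtree without leaves has to be found without choosing anything, so every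
    step must be canonical.  Call a downward closed set of vertices good when it
    meets all levels.  There is a canonical operation that shrinks good sets:

    - if the good set [X] has leaves, remove all of them;
    - if it has none and some level contains two vertices with different numbers
      of immediate successors in [X], take the least such level [n] and the
      least number [k] of successors that occurs on it, and keep the vertices
      that are comparable to some vertex of level [n] with exactly [k]
      successors.

    The result is again good ([good_step]), and a good set that the operation
    leaves unchanged is leafless and balanced ([step_fixpoint]): otherwise a
    vertex of level [n] with a number of successors other than [k] would be
    comparable to another vertex of its own level.

    One application may destroy the balance on lower levels, so the operation is
    iterated transfinitely, taking intersections at limits.  The intersection of
    a chain of good sets is good because the levels are finite: on a finite
    level, a chain of sets that all meet it has a common point
    ([chain_meets_finite], [good_intersection]).  The iteration is carried out in the manner of
    Bourbaki and Witt, without ordinals: the least family of sets that contains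
    [T] and is closed under the operation and under nonempty intersections is a
    chain, and its intersection is a fixed point ([deflationary_fixpoint]).

    The levels of a tree are given by transfinite recursion, and have to be
    computed for the subtree from those of [T].  They are unique because the
    index of the level of a vertex is the set of the indices of the levels of
    the vertices below it ([levelling_unique]); in a downward closed set the
    levels are the traces of the levels of [T].

    All this takes place inside the model [M], where a collection is a set only
    if a formula defines it.  The first part makes that requirement nearly
    invisible: [definable] is closed under the logical operations, so that
    Separation and Replacement can be applied to predicates written in the
    ordinary way, and the tactic [define] finds the formula. *)

Set Implicit Arguments.
Unset Strict Implicit.

(** * Definable predicates *)

Section Definability.

Context {M : structure}.

Fixpoint rename (r : nat -> nat) (p : formula) : formula :=
  let up i := match i with O => O | S j => S (r j) end in
  match p with
  | f_mem i j => f_mem (r i) (r j)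
  | f_eq i j => f_eq (r i) (r j)
  | f_atom i => f_atom (r i)
  | f_false => f_false
  | f_imp p q => f_imp (rename r p) (rename r q)
  | f_and p q => f_and (rename r p) (rename r q)
  | f_or p q => f_or (rename r p) (rename r q)
  | f_all p => f_all (rename up p)
  | f_ex p => f_ex (rename up p)
  end.

Lemma sat_rename (p : formula) : forall (r : nat -> nat) (e e' : nat -> M),
  (forall i, e' (r i) = e i) -> (sat e' (rename r p) <-> sat e p).
Proof.
  induction p; simpl; intros r e e' H; rewrite ?H; try tauto.
  1-3: rewrite (IHp1 _ _ _ H), (IHp2 _ _ _ H); tauto.
  - split; intros K x; specialize (K x); revert K; apply IHp;
      intros [|i]; simpl; auto.
  - split; intros [x K]; exists x; revert K; apply IHp;
      intros [|i]; simpl; auto.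
Qed.

Definition term : Type := (nat + M)%type.

Definition value (e : nat -> M) (t : term) : M :=
  match t with inl i => e i | inr c => c end.

Definition is_term (t : (nat -> M) -> M) : Prop :=
  exists a : term, forall e, t e = value e a.

(** Substituting variables and constants for the variables of the formula makes
    the parameters part of the predicate: elements of [M] may occur in [P]
    directly. *)
Definition definable (P : (nat -> M) -> Prop) : Prop :=
  exists (p : formula) (s : nat -> term),
    forall e, P e <-> sat (fun i => value e (s i)) p.

Lemma term_var (i : nat) : is_term (fun e => e i).
Proof. exists (inl i); reflexivity. Qed.

Lemma term_const (c : M) : is_term (fun _ => c).
Proof. exists (inr c); reflexivity. Qed.

Lemma definable_mem (t u : (nat -> M) -> M) :
  is_term t -> is_term u -> definable (fun e => t e ∈ u e).
Proof.
  intros [a Ha] [b Hb]; exists (f_mem 0 1), (fun i : nat => if i then a else b).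
  intro e; simpl; rewrite Ha, Hb; reflexivity.
Qed.

Lemma definable_eq (t u : (nat -> M) -> M) :
  is_term t -> is_term u -> definable (fun e => t e = u e).
Proof.
  intros [a Ha] [b Hb]; exists (f_eq 0 1), (fun i : nat => if i then a else b).
  intro e; simpl; rewrite Ha, Hb; reflexivity.
Qed.

Lemma definable_atom (t : (nat -> M) -> M) :
  is_term t -> definable (fun e => atom (t e)).
Proof.
  intros [a Ha]; exists (f_atom 0), (fun _ => a).
  intro e; simpl; rewrite Ha; reflexivity.
Qed.

Lemma definable_false : definable (fun _ => False).
Proof. exists f_false, inl; simpl; tauto. Qed.

(** The variables of the two formulas are renamed to even and odd numbers, which
    leaves room for both substitutions. *)
Lemma common_substitution (P Q : (nat -> M) -> Prop) :
  definable P -> definable Q ->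
  exists (p q : formula) (s : nat -> term), forall e,
    (P e <-> sat (fun i => value e (s i)) p) /\
    (Q e <-> sat (fun i => value e (s i)) q).
Proof.
  intros [p [s Hp]] [q [t Hq]].
  exists (rename (fun i => 2 * i) p), (rename (fun i => S (2 * i)) q),
    (fun i => if Nat.even i then s (Nat.div2 i) else t (Nat.div2 i)).
  intro e; rewrite Hp, Hq; split; symmetry; apply sat_rename; intro i.
  - rewrite Nat.even_even, Nat.div2_double; reflexivity.
  - rewrite Nat.even_succ, Nat.odd_even, Nat.div2_succ_double; reflexivity.
Qed.

Lemma definable_imp (P Q : (nat -> M) -> Prop) :
  definable P -> definable Q -> definable (fun e => P e -> Q e).
Proof.
  intros HP HQ; destruct (common_substitution HP HQ) as [p [q [s H]]].
  exists (f_imp p q), s; intro e; simpl.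
  destruct (H e) as [-> ->]; reflexivity.
Qed.

Lemma definable_and (P Q : (nat -> M) -> Prop) :
  definable P -> definable Q -> definable (fun e => P e /\ Q e).
Proof.
  intros HP HQ; destruct (common_substitution HP HQ) as [p [q [s H]]].
  exists (f_and p q), s; intro e; simpl.
  destruct (H e) as [-> ->]; reflexivity.
Qed.

Lemma definable_or (P Q : (nat -> M) -> Prop) :
  definable P -> definable Q -> definable (fun e => P e \/ Q e).
Proof.
  intros HP HQ; destruct (common_substitution HP HQ) as [p [q [s H]]].
  exists (f_or p q), s; intro e; simpl.
  destruct (H e) as [-> ->]; reflexivity.
Qed.

(** Under a quantifier, the bound variable must be the variable 0 of the formula
    and nothing else may be: all variables that stand for anything but the bound
    one are moved up by one. *)
Lemma bind_first (P : (nat -> M) -> Prop) :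
  definable P ->
  exists (p : formula) (s : nat -> term), forall e x,
    P (scons x e) <-> sat (scons x (fun i => value e (s i))) p.
Proof.
  intros [p [s Hp]].
  exists (rename (fun i => match s i with inl 0 => 0 | _ => S i end) p),
    (fun i => match s i with inl (S j) => inl j | t => t end).
  intros e x; rewrite Hp; symmetry; apply sat_rename.
  intro i; destruct (s i) as [[|j]|c] eqn:E; simpl; rewrite ?E; reflexivity.
Qed.

Lemma definable_all (P : (nat -> M) -> M -> Prop) :
  definable (fun e => P (fun i => e (S i)) (e 0)) ->
  definable (fun e => forall x, P e x).
Proof.
  intro H; destruct (bind_first H) as [p [s K]].
  exists (f_all p), s; intro e; simpl.
  split; intros L x; apply (K e x); apply L.
Qed.

Lemma definable_ex (P : (nat -> M) -> M -> Prop) :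
  definable (fun e => P (fun i => e (S i)) (e 0)) ->
  definable (fun e => exists x, P e x).
Proof.
  intro H; destruct (bind_first H) as [p [s K]].
  exists (f_ex p), s; intro e; simpl.
  split; intros [x L]; exists x; apply (K e x); apply L.
Qed.

(** The predicates are evaluated at the first variables of the environment, so
    that quantifying over them is an instance of the rules for quantifiers. *)
Definition definable1 (P : M -> Prop) : Prop := definable (fun e => P (e 0)).

Definition definable2 (R : M -> M -> Prop) : Prop :=
  definable (fun e => R (e 0) (e 1)).

Lemma definable2_subst (R : M -> M -> Prop) (t u : (nat -> M) -> M) :
  definable2 R -> is_term t -> is_term u -> definable (fun e => R (t e) (u e)).
Proof.
  intros [p [s H]] [a Ha] [b Hb].
  exists (rename (fun i => i) p),
    (fun i => match s i with
              | inl 0 => a | inl 1 => b | inl _ => a | inr c => inr c end).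
  intro e; rewrite (H (scons (t e) (scons (u e) (fun _ => t e)))).
  symmetry; apply sat_rename; intro i.
  destruct (s i) as [[|[|j]]|c]; simpl; auto.
Qed.

Lemma definable1_subst (P : M -> Prop) (t : (nat -> M) -> M) :
  definable1 P -> is_term t -> definable (fun e => P (t e)).
Proof.
  intros H Ht; exact (definable2_subst (R := fun x _ => P x) H Ht Ht).
Qed.

End Definability.

Ltac unfold_notions :=
  unfold is_set, is_empty, subset, is_succ, inductive_set, is_upair,
    is_opair, related, function_on, bijection, equinumerous, is_ordinal,
    is_omega, finite, partial_order, is_tree, minimal, is_level, has_levels,
    is_leaf, is_subtree, immediate_succ, is_succ_set, finite_branching,
    balanced, unique, iff, not.

(** Extended below with each new notion, so that [define] can see through it. *)
Ltac unfold_more := fail.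

Ltac define1 :=
  cbv beta;
  match goal with
  | |- is_term (fun _ => ?c) => apply (term_const c)
  | |- is_term (fun e => e ?i) => apply (term_var i)
  | |- definable (fun e => exists x, _) => apply definable_ex
  | |- definable (fun e => _ /\ _) => apply definable_and
  | |- definable (fun e => _ \/ _) => apply definable_or
  | |- definable (fun e => False) => apply definable_false
  | |- definable (fun e => _ ∈ _) => apply definable_mem
  | |- definable (fun e => _ = _) => apply definable_eq
  | |- definable (fun e => atom _) => apply definable_atom
  | |- definable (fun e => _ -> _) => apply definable_imp
  | |- definable (fun e => forall x, _) => apply definable_all
  | H : definable1 ?P |- definable (fun e => ?P _) => apply (definable1_subst H)
  | H : definable2 ?P |- definable (fun e => ?P _ _) =>
      apply (definable2_subst H)
  | |- definable _ => progress unfold_more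
  | |- definable _ => progress unfold_notions
  end.

Ltac define := unfold definable1, definable2; repeat define1.

(** * Sets, pairs and functions in the model *)

Section Sets.

Context {M : structure} (ZFA : models_ZFA M).

Lemma separation (P : M -> Prop) (x : M) :
  definable1 P ->
  exists y : M, is_set y /\ forall z, z ∈ y <-> z ∈ x /\ P z.
Proof.
  intro H; destruct (bind_first H) as [p [s K]].
  destruct (zfa_separation ZFA p (fun i => value (fun _ => x) (s i)) x)
    as [y [Hy L]].
  exists y; split; [exact Hy|].
  intro z; rewrite L, <- K; reflexivity.
Qed.

Lemma replacement (R : M -> M -> Prop) (x : M) :
  definable2 R ->
  (forall u v v', u ∈ x -> R u v -> R u v' -> v = v') ->
  exists y : M, is_set y /\ forall v, v ∈ y <-> exists u, u ∈ x /\ R u v.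
Proof.
  intros [p [s K]] Hfun.
  pose (q := rename (fun i => match s i with
                              | inl 0 => 0 | inl 1 => 1 | _ => S (S i) end) p).
  pose (e := fun i => value (fun _ => x) (s i)).
  assert (L : forall u v, R u v <-> sat (scons u (scons v e)) q).
  { intros u v; rewrite (K (scons u (scons v (fun _ => x)))).
    symmetry; apply sat_rename; intro i; unfold e.
    destruct (s i) as [[|[|j]]|c] eqn:E; simpl; rewrite ?E; reflexivity. }
  destruct (zfa_replacement ZFA (p := q) (e := e) (x := x)) as [y [Hy N]].
  - intros u v v'; rewrite <- !L; apply Hfun.
  - exists y; split; [exact Hy|]; intro v; rewrite N.
    split; intros [u [Hu Huv]]; exists u; split; auto; apply L; exact Huv.
Qed.

Lemma extensionality (x y : M) :
  is_set x -> is_set y -> (forall z, z ∈ x <-> z ∈ y) -> x = y.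
Proof. exact (@zfa_extensionality M ZFA x y). Qed.

Lemma upair_exists (x y : M) : exists p : M, is_upair p x y.
Proof. exact (zfa_pairing ZFA x y). Qed.

Lemma upair_functional (p q x y : M) :
  is_upair p x y -> is_upair q x y -> p = q.
Proof.
  intros [Hp Kp] [Hq Kq]; apply extensionality; auto.
  intro z; rewrite Kp, Kq; reflexivity.
Qed.

Lemma upair_injective (p x y z : M) :
  is_upair p x y -> is_upair p x z -> y = z.
Proof.
  intros [_ H] [_ K].
  destruct (proj1 (K y) (proj2 (H y) (or_intror eq_refl))) as [->|]; auto.
  destruct (proj1 (H z) (proj2 (K z) (or_intror eq_refl))) as [|]; auto.
Qed.

Lemma upair_singleton (p x y z : M) :
  is_upair p x x -> is_upair p y z -> x = y /\ x = z.
Proof.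
  intros [_ H] [_ K]; split; symmetry.
  - destruct (proj1 (H y) (proj2 (K y) (or_introl eq_refl))); auto.
  - destruct (proj1 (H z) (proj2 (K z) (or_intror eq_refl))); auto.
Qed.

Lemma opair_exists (x y : M) : exists p : M, is_opair p x y.
Proof.
  destruct (upair_exists x x) as [s Hs], (upair_exists x y) as [d Hd].
  destruct (upair_exists s d) as [p Hp]; exists p, s, d; auto.
Qed.

Lemma opair_functional (p q x y : M) :
  is_opair p x y -> is_opair q x y -> p = q.
Proof.
  intros [s [d [Hs [Hd Hp]]]] [s' [d' [Hs' [Hd' Hq]]]].
  rewrite (upair_functional Hs' Hs), (upair_functional Hd' Hd) in Hq.
  exact (upair_functional Hp Hq).
Qed.

Lemma opair_injective (p x y x' y' : M) :
  is_opair p x y -> is_opair p x' y' -> x = x' /\ y = y'.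
Proof.
  intros [s [d [Hs [Hd Hp]]]] [s' [d' [Hs' [Hd' Hp']]]].
  assert (x = x') as <-.
  { destruct (proj1 (proj2 Hp' s) (proj2 (proj2 Hp s) (or_introl eq_refl)))
      as [-> | ->].
    - apply (upair_singleton Hs Hs').
    - apply (upair_singleton Hs Hd'). }
  split; [reflexivity|].
  rewrite (upair_functional Hs' Hs) in Hp'.
  rewrite (upair_injective Hp Hp') in Hd.
  exact (upair_injective Hd Hd').
Qed.

Lemma related_pair (r p x y : M) : is_opair p x y -> (related r x y <-> p ∈ r).
Proof.
  intro H; split.
  - intros [q [Hq K]]; rewrite (opair_functional H Hq); exact K.
  - intro K; exists p; auto.
Qed.

Lemma empty_unique (e e' : M) : is_empty e -> is_empty e' -> e = e'.
Proof.
  intros [He Ke] [He' Ke']; apply extensionality; auto.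
  intro z; split; intro Hz; [destruct (Ke z Hz)|destruct (Ke' z Hz)].
Qed.

Lemma succ_unique (x y y' : M) : is_succ y x -> is_succ y' x -> y = y'.
Proof.
  intros [Hy Ky] [Hy' Ky']; apply extensionality; auto.
  intro z; rewrite Ky, Ky'; reflexivity.
Qed.

Lemma not_self_member (x : M) : ~ x ∈ x.
Proof.
  intro H; destruct (upair_exists x x) as [s [_ Hs]].
  destruct (zfa_foundation ZFA (x := s)) as [y [Hy K]].
  - exists x; apply Hs; auto.
  - apply Hs in Hy; assert (y = x) as -> by tauto.
    apply (K x H); apply Hs; auto.
Qed.

Definition adjoin (c b x : M) : Prop :=
  is_set c /\ forall z, z ∈ c <-> z ∈ b \/ z = x.

(** Replacement turns a definable functional relation into its graph.  All
    functions of the model that are needed come from this lemma. *)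
Lemma function_of_relation (R : M -> M -> Prop) (d : M) :
  definable2 R -> (forall x, x ∈ d -> exists! y, R x y) ->
  exists f : M, function_on f d /\
    forall x y, related f x y <-> x ∈ d /\ R x y.
Proof.
  intros HR Hfun.
  destruct (replacement (R := fun x p => exists y, R x y /\ is_opair p x y)
    (x := d)) as [f [Hf K]].
  { define. }
  { intros x p p' Hx [y [Hy Hp]] [y' [Hy' Hp']].
    destruct (Hfun x Hx) as [y0 [_ U]].
    rewrite <- (U y Hy) in Hp; rewrite <- (U y' Hy') in Hp'.
    exact (opair_functional Hp Hp'). }
  assert (L : forall x y, related f x y <-> x ∈ d /\ R x y).
  { intros x y; destruct (opair_exists x y) as [p Hp].
    rewrite (related_pair f Hp), K; split.
    - intros [x' [Hx' [y' [HR' Hp']]]].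
      destruct (opair_injective Hp Hp') as [-> ->]; auto.
    - intros [Hx Hy]; exists x; split; auto; exists y; auto. }
  exists f; split; [split; [exact Hf|split]|exact L].
  - intros p Hp; apply K in Hp; destruct Hp as [x [Hx [y [_ Hp]]]].
    exists x, y; auto.
  - intros x Hx; destruct (Hfun x Hx) as [y [Hy U]]; exists y; split.
    + apply L; auto.
    + intros y' Hy'; apply U; apply (proj1 (L x y') Hy').
Qed.

Lemma related_domain (f d x y : M) : function_on f d -> related f x y -> x ∈ d.
Proof.
  intros [_ [H _]] [p [Hp K]]; destruct (H p K) as [x' [y' [Hx' Hp']]].
  destruct (opair_injective Hp Hp') as [-> _]; exact Hx'.
Qed.

Lemma function_unique (f d x y y' : M) :
  function_on f d -> related f x y -> related f x y' -> y = y'.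
Proof.
  intros Hf H K; pose proof (related_domain Hf H) as Hx.
  destruct Hf as [_ [_ Hf]]; destruct (Hf x Hx) as [y0 [_ U]].
  rewrite <- (U y H); exact (U y' K).
Qed.

Lemma bijection_of_relation (R : M -> M -> Prop) (a b : M) :
  definable2 R ->
  (forall x, x ∈ a -> exists y, R x y) ->
  (forall x y, x ∈ a -> R x y -> y ∈ b) ->
  (forall x y y', x ∈ a -> R x y -> R x y' -> y = y') ->
  (forall x x' y, x ∈ a -> x' ∈ a -> R x y -> R x' y -> x = x') ->
  (forall y, y ∈ b -> exists x, x ∈ a /\ R x y) ->
  equinumerous a b.
Proof.
  intros HR Htot Hb Hfun Hinj Hsurj.
  destruct (function_of_relation HR (d := a)) as [f [Hf K]].
  { intros x Hx; destruct (Htot x Hx) as [y Hy]; exists y; split; auto.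
    intros y' Hy'; exact (Hfun x y y' Hx Hy Hy'). }
  exists f; split; [exact Hf|repeat split].
  - intros x y; rewrite K; intros [Hx Hy]; eauto.
  - intros x x' y; rewrite !K; intros [Hx Hy] [Hx' Hy']; eauto.
  - intros y Hy; destruct (Hsurj y Hy) as [x Hx]; exists x; apply K; exact Hx.
Qed.

Lemma bijection_total (f a b x : M) :
  bijection f a b -> x ∈ a -> exists y, related f x y.
Proof.
  intros [[_ [_ H]] _] Hx; destruct (H x Hx) as [y [Hy _]]; eauto.
Qed.

Lemma equinumerous_sym (a b : M) : equinumerous a b -> equinumerous b a.
Proof.
  intros [f Hf]; pose proof Hf as [Hfun [Hb [Hinj Hsurj]]].
  apply (bijection_of_relation (R := fun y x => related f x y)).
  - define.
  - exact Hsurj.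
  - intros y x _ H; exact (related_domain Hfun H).
  - intros y x x' _; apply Hinj.
  - intros y y' x _ _; exact (function_unique Hfun).
  - intros x Hx; destruct (bijection_total Hf Hx) as [y Hy]; eauto.
Qed.

Lemma equinumerous_trans (a b c : M) :
  equinumerous a b -> equinumerous b c -> equinumerous a c.
Proof.
  intros [f Hf] [g Hg].
  pose proof Hf as [Ff [Hb [If Sf]]]; pose proof Hg as [Fg [Hc [Ig Sg]]].
  apply (bijection_of_relation
           (R := fun x z => exists y, related f x y /\ related g y z)).
  - define.
  - intros x Hx; destruct (bijection_total Hf Hx) as [y Hy].
    destruct (bijection_total Hg (Hb x y Hy)) as [z Hz]; eauto.
  - intros x z _ [y [_ Hz]]; eauto.
  - intros x z z' _ [y [Hy Hz]] [y' [Hy' Hz']].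
    rewrite <- (function_unique Ff Hy Hy') in Hz'.
    exact (function_unique Fg Hz Hz').
  - intros x x' z _ _ [y [Hy Hz]] [y' [Hy' Hz']].
    rewrite <- (Ig y y' z Hz Hz') in Hy'; eauto.
  - intros z Hz; destruct (Sg z Hz) as [y Hy].
    destruct (Sf y (related_domain Fg Hy)) as [x Hx].
    exists x; split; eauto; exact (related_domain Ff Hx).
Qed.

End Sets.

Ltac unfold_more ::= unfold adjoin.

(** * Natural numbers and finite sets *)

Section Finite.

Context {M : structure} (ZFA : models_ZFA M).
Context {omega : M} (Homega : is_omega omega).

Lemma omega_inductive : inductive_set omega.
Proof.
  destruct Homega as [_ Ho].
  destruct (zfa_infinity ZFA) as [i [_ Hi]]; split.
  - pose proof Hi as [[e [He _]] _]; exists e; split; [exact He|].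
    apply Ho; intros j [[e' [He' Hj]] _].
    rewrite (empty_unique ZFA He He'); assumption.
  - intros x Hx; pose proof (proj1 (Ho x) Hx) as K.
    destruct (proj2 Hi x (K i Hi)) as [y [Hy _]]; exists y; split; [exact Hy|].
    apply Ho; intros j Hj; destruct (proj2 Hj x (K j Hj)) as [y' [Hy' L]].
    rewrite (succ_unique ZFA Hy Hy'); exact L.
Qed.

Lemma omega_induction (P : M -> Prop) :
  definable1 P ->
  (forall e, is_empty e -> P e) ->
  (forall n n', n ∈ omega -> P n -> is_succ n' n -> P n') ->
  forall n, n ∈ omega -> P n.
Proof.
  intros HP H0 HS n Hn.
  destruct (separation ZFA omega HP) as [i [_ Hi]].
  apply (Hi n), (proj1 (proj2 Homega n) Hn); split.
  - destruct (proj1 omega_inductive) as [e [He Ke]]; exists e; rewrite Hi; auto.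
  - intros x Hx; apply Hi in Hx; destruct Hx as [Hx Px].
    destruct (proj2 omega_inductive x Hx) as [y [Hy Ky]]; exists y.
    rewrite Hi; split; [|split]; eauto.
Qed.

(** A numbering of [a] by a natural number reduces this to induction on [omega]:
    the preimage of [k + 1] has at most one element more than that of [k]. *)
Lemma finite_induction (P : M -> Prop) (a : M) :
  definable1 P ->
  (forall e, is_empty e -> P e) ->
  (forall b c x, P b -> x ∈ a -> adjoin c b x -> P c) ->
  is_set a -> finite a -> P a.
Proof.
  intros HP H0 HS Ha [w [n [Hw [Hn [f Hf]]]]].
  pose proof Hf as [Ff [Hb [If Sf]]].
  (* Beyond [n] the preimages no longer grow, so all of [omega] can serve as the
     range of the induction. *)
  assert (K : forall k, k ∈ omega -> forall b, is_set b ->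
    (forall x, x ∈ b <-> x ∈ a /\ exists y, related f x y /\ y ∈ k) -> P b).
  { apply (omega_induction (P := fun k => forall b, is_set b ->
      (forall x, x ∈ b <-> x ∈ a /\ exists y, related f x y /\ y ∈ k) -> P b)).
    - define.
    - intros e He b Hsb Hb'; apply H0; split; [exact Hsb|].
      intros x Hx; apply Hb' in Hx; destruct Hx as [_ [y [_ Hy]]].
      exact (proj2 He y Hy).
    - intros k k' _ IH Hk' b Hsb Hb'.
      destruct (separation ZFA a
        (P := fun x => exists y, related f x y /\ y ∈ k)) as [c [Hsc Hc]].
      { define. }
      destruct (classic (k ∈ n)) as [Hkn|Hkn].
      + destruct (Sf k Hkn) as [x0 Hx0].
        assert (Hx0a := related_domain ZFA Ff Hx0).
        apply (HS c b x0); [apply IH; auto| exact Hx0a |].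
        split; [exact Hsb|]; intro x; rewrite Hb', Hc; split.
        * intros [Hx [y [Hy Hyk]]]; apply (proj2 Hk') in Hyk.
          destruct Hyk as [Hyk | ->]; [left; eauto|right; eauto].
        * intros [[Hx [y [Hy Hyk]]] | ->].
          -- split; [exact Hx|]; exists y; split; auto.
             apply (proj2 Hk'); auto.
          -- split; [exact Hx0a|]; exists k; split; auto.
             apply (proj2 Hk'); auto.
      + apply IH; auto; intro x; rewrite Hb'; split.
        * intros [Hx [y [Hy Hyk]]]; split; auto; exists y; split; auto.
          apply (proj2 Hk') in Hyk; destruct Hyk as [Hyk | ->]; auto.
          exfalso; eauto.
        * intros [Hx [y [Hy Hyk]]]; split; auto; exists y; split; auto.
          apply (proj2 Hk'); auto. }
  apply (K n).
  - apply (proj2 Homega); apply (proj2 Hw); exact Hn.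
  - exact Ha.
  - intro x; split; [|tauto]; intro Hx; split; [exact Hx|].
    destruct (bijection_total Hf Hx) as [y Hy]; eauto.
Qed.

Lemma finite_empty (e : M) : is_empty e -> finite e.
Proof.
  intro He; exists omega, e; split; [exact Homega|split].
  - destruct (proj1 omega_inductive) as [e' [He' Ho]].
    rewrite (empty_unique ZFA He He'); exact Ho.
  - apply (bijection_of_relation ZFA (R := fun x y => x = y)).
    + define.
    + eauto.
    + intros x y Hx <-; exact Hx.
    + congruence.
    + congruence.
    + eauto.
Qed.

Lemma finite_adjoin (b c x : M) :
  is_set b -> finite b -> adjoin c b x -> finite c.
Proof.
  intros Hb [w [n [Hw [Hn [f Hf]]]]] [Hc Kc].
  destruct (classic (x ∈ b)) as [Hx|Hx].
  { rewrite (@extensionality _ ZFA c b); auto.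
    - exists w, n; repeat split; auto; try apply Hw; exists f; exact Hf.
    - intro z; rewrite Kc; split; [intros [ | -> ]; auto|auto]. }
  assert (Hno : n ∈ omega).
  { apply (proj2 Homega); apply (proj2 Hw); exact Hn. }
  destruct (proj2 omega_inductive n Hno) as [n' [Hn' Hno']].
  exists omega, n'; split; [exact Homega|split; [exact Hno'|]].
  pose proof Hf as [Ff [Bf [If Sf]]].
  assert (Db : forall z y, related f z y -> z <> x /\ y <> n).
  { intros z y Hzy; split; intros ->.
    - exact (Hx (related_domain ZFA Ff Hzy)).
    - exact (not_self_member ZFA (Bf z n Hzy)). }
  apply (bijection_of_relation ZFA
           (R := fun z y => related f z y \/ (z = x /\ y = n))).
  - define.
  - intros z Hz; apply Kc in Hz; destruct Hz as [Hz | ->]; [|eauto].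
    destruct (bijection_total Hf Hz) as [y Hy]; eauto.
  - intros z y _ [Hy|[_ ->]]; apply (proj2 Hn'); eauto.
  - intros z y y' _ [Hy|[-> ->]] [Hy'|[E E']]; try congruence.
    + exact (function_unique ZFA Ff Hy Hy').
    + destruct (Db _ _ Hy); congruence.
    + destruct (Db _ _ Hy'); congruence.
  - intros z z' y _ _ [Hy|[-> ->]] [Hy'|[E E']]; try congruence.
    + exact (If _ _ _ Hy Hy').
    + destruct (Db _ _ Hy); congruence.
    + destruct (Db _ _ Hy'); congruence.
  - intros y Hy; apply (proj2 Hn') in Hy; destruct Hy as [Hy | ->].
    + destruct (Sf y Hy) as [z Hz]; exists z; split; auto.
      apply Kc; left; exact (related_domain ZFA Ff Hz).
    + exists x; split; auto; apply Kc; auto.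
Qed.

Lemma finite_subset (a b : M) :
  is_set a -> finite a -> is_set b -> subset b a -> finite b.
Proof.
  intros Ha Fa Hb Hba.
  assert (K : forall c, is_set c -> (forall z, z ∈ c <-> z ∈ a /\ z ∈ b) ->
    finite c).
  { apply (finite_induction (P := fun a' => forall c, is_set c ->
      (forall z, z ∈ c <-> z ∈ a' /\ z ∈ b) -> finite c) (a := a)); auto.
    - define.
    - intros e He c Hc Kc; apply finite_empty; split; [exact Hc|].
      intros z Hz; apply Kc in Hz; exact (proj2 He z (proj1 Hz)).
    - intros a1 a2 x IH Hx [Ha2 Ka2] c Hc Kc.
      destruct (separation ZFA b (P := fun z => z ∈ a1)) as [c1 [Hc1 Kc1]].
      { define. }
      assert (Fc1 : finite c1).
      { apply IH; auto; intro z; rewrite Kc1; tauto. }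
      destruct (classic (x ∈ b)) as [Hxb|Hxb].
      + apply (@finite_adjoin c1 c x); auto; split; [exact Hc|].
        intro z; rewrite Kc, Kc1, Ka2; split; [tauto|].
        intros [ | -> ]; tauto.
      + rewrite (@extensionality _ ZFA c c1); auto.
        intro z; rewrite Kc, Kc1, Ka2; split; [|tauto].
        intros [[ | -> ] ?]; tauto. }
  apply K; auto; intro z; split; [auto|tauto].
Qed.

(** Compactness.  If no point of [a] were common to the chain, each would be
    missed by some member; adding the points one at a time and passing to the
    smaller of two members gives a single member that misses all of [a]. *)
Lemma chain_meets_finite (a C : M) :
  is_set a -> finite a ->
  (exists Y, Y ∈ C) ->
  (forall Y Z, Y ∈ C -> Z ∈ C -> subset Y Z \/ subset Z Y) ->
  (forall Y, Y ∈ C -> exists x, x ∈ a /\ x ∈ Y) ->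
  exists x, x ∈ a /\ forall Y, Y ∈ C -> x ∈ Y.
Proof.
  intros Ha Fa Hne Hchain Hmeet; apply NNPP; intro N.
  assert (K : exists Y, Y ∈ C /\ forall x, x ∈ a -> ~ x ∈ Y).
  { apply (finite_induction (P := fun b =>
      exists Y, Y ∈ C /\ forall x, x ∈ b -> ~ x ∈ Y) (a := a)); auto.
    - define.
    - intros e He; destruct Hne as [Y HY]; exists Y; split; [exact HY|].
      intros x Hx; destruct (proj2 He x Hx).
    - intros b c x [Y [HY KY]] Hx [_ Kc].
      assert (exists Z, Z ∈ C /\ ~ x ∈ Z) as [Z [HZ KZ]].
      { apply NNPP; intro L; apply N; exists x; split; [exact Hx|].
        intros Z HZ; apply NNPP; intro; apply L; eauto. }
      destruct (Hchain Y Z HY HZ) as [S|S].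
      + exists Y; split; [exact HY|]; intros z Hz Hz'; apply Kc in Hz.
        destruct Hz as [Hz | ->]; [exact (KY z Hz Hz')|exact (KZ (S _ Hz'))].
      + exists Z; split; [exact HZ|]; intros z Hz Hz'; apply Kc in Hz.
        destruct Hz as [Hz | ->]; [exact (KY z Hz (S _ Hz'))|exact (KZ Hz')]. }
  destruct K as [Y [HY KY]]; destruct (Hmeet Y HY) as [x [Hx Hx']].
  exact (KY x Hx Hx').
Qed.

End Finite.

(** * Fixed points of shrinking operations *)

Definition is_part {M : structure} (P : M -> Prop) (Y X : M) : Prop :=
  is_set Y /\ forall x, x ∈ Y <-> x ∈ X /\ P x.

Definition is_intersection {M : structure} (Y C : M) : Prop :=
  is_set Y /\ forall x, x ∈ Y <-> forall X, X ∈ C -> x ∈ X.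

Ltac unfold_more ::= unfold adjoin, is_part, is_intersection.

Section FixedPoint.

Context {M : structure} (ZFA : models_ZFA M).
Context {T : M} {step : M -> M -> Prop}.
Context (Tset : is_set T) (Dstep : definable2 step).

(** Closure is asked for all nonempty subfamilies, not only for chains: the least
    such family turns out to be a chain anyway, and the argument is shorter. *)
Definition tower (G : M) : Prop :=
  T ∈ G /\
  (forall X Y, X ∈ G -> is_part (step X) Y X -> Y ∈ G) /\
  (forall C Y, (exists X, X ∈ C) -> subset C G -> is_intersection Y C -> Y ∈ G).

Lemma part_exists (X : M) : exists Y, is_part (step X) Y X.
Proof. apply (separation ZFA); define. Qed.

Lemma intersection_exists (C : M) :
  (exists X, X ∈ C) -> exists Y, is_intersection Y C.
Proof.
  intros [X HX].
  destruct (separation ZFA X (P := fun x => forall X, X ∈ C -> x ∈ X))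
    as [Y [HY K]]; [define|].
  exists Y; split; [exact HY|]; intro x; rewrite K; split; [tauto|auto].
Qed.

Lemma least_tower : exists F, tower F /\
  (forall X, X ∈ F -> is_set X /\ subset X T) /\
  forall Q, definable1 Q -> Q T ->
    (forall X Y, X ∈ F -> Q X -> is_part (step X) Y X -> Q Y) ->
    (forall C Y, (exists X, X ∈ C) -> subset C F ->
       (forall X, X ∈ C -> Q X) -> is_intersection Y C -> Q Y) ->
    forall X, X ∈ F -> Q X.
Proof.
  destruct (zfa_powerset ZFA T) as [p [_ Hp]].
  destruct (separation ZFA p (P := fun X => forall G, tower G -> X ∈ G))
    as [F [_ HF]].
  { unfold tower; define. }
  assert (HFp : forall X, X ∈ F -> is_set X /\ subset X T).
  { intros X HX; exact (proj1 (Hp X) (proj1 (proj1 (HF X) HX))). }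
  assert (TF : tower F).
  { split; [|split].
    - apply HF; split; [apply Hp; split; [exact Tset|intro z; auto]|].
      intros G [HG _]; exact HG.
    - intros X Y HX HY; apply HF; split.
      + apply Hp; split; [apply HY|]; intros z Hz.
        apply (HFp X HX), (proj2 HY), Hz.
      + intros G HG; apply (proj1 (proj2 HG) X Y); auto.
        apply HF in HX; apply HX; exact HG.
    - intros C Y Hne HC HY; apply HF; split.
      + apply Hp; split; [apply HY|]; intros z Hz.
        destruct Hne as [X HX]; apply (HFp X (HC X HX)).
        exact (proj1 (proj2 HY z) Hz X HX).
      + intros G HG; apply (proj2 (proj2 HG) C Y); auto.
        intros X HX; apply HC, HF in HX; apply HX; exact HG. }
  exists F; split; [exact TF|split; [exact HFp|]].
  intros Q HQ QT QS QI X HX.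
  destruct (separation ZFA F HQ) as [G [_ HG]].
  apply HG, (proj2 (proj1 (HF X) HX)); split; [|split].
  - apply HG; split; [apply TF|exact QT].
  - intros U Y HU HY; apply HG in HU; destruct HU as [HU QU].
    apply HG; split; [exact (proj1 (proj2 TF) U Y HU HY)|].
    exact (QS U Y HU QU HY).
  - intros C Y Hne HC HY.
    assert (HC' : subset C F) by (intros U HU; apply HG, HC, HU).
    apply HG; split; [exact (proj2 (proj2 TF) C Y Hne HC' HY)|].
    apply (QI C Y); auto; intros U HU; apply HG, HC, HU.
Qed.

(** The Bourbaki-Witt theorem for [X |-> {x in X | step X x}].  Only
    intersections of chains have to preserve [Good]; that is enough because the
    least tower is a chain.  The intersection of the whole tower belongs to it,
    hence so does its image, which therefore contains the intersection. *)
Lemma deflationary_fixpoint (Good : M -> Prop) :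
  definable1 Good -> Good T ->
  (forall X Y, Good X -> is_part (step X) Y X -> Good Y) ->
  (forall C Y, (exists X, X ∈ C) -> (forall X, X ∈ C -> Good X) ->
     (forall X Z, X ∈ C -> Z ∈ C -> subset X Z \/ subset Z X) ->
     is_intersection Y C -> Good Y) ->
  exists X, is_set X /\ Good X /\ forall x, x ∈ X -> step X x.
Proof.
  intros DGood GT GS GI.
  destruct least_tower as [F [TF [HF ind]]].
  pose proof TF as [FT [FS FI]].
  (* Extreme members are those that the operation cannot jump over from above.
     Every member of [F] is comparable to every extreme one, and all turn out to
     be extreme. *)
  pose (extreme := fun c => forall X Y, X ∈ F -> subset c X -> X <> c ->
    is_part (step X) Y X -> subset c Y).
  assert (dichotomy : forall c, c ∈ F -> extreme c -> forall c',
    is_part (step c) c' c -> forall X, X ∈ F -> subset c X \/ subset X c').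
  { intros c Hc Ec c' Hc'; apply ind.
    - define.
    - left; apply (HF c Hc).
    - intros X Y HX [HcX|HXc'] HY.
      + destruct (classic (X = c)) as [->|NXc].
        * right; intros z Hz; apply (proj2 Hc'), (proj2 HY), Hz.
        * left; exact (Ec X Y HX HcX NXc HY).
      + right; intros z Hz; apply HXc', (proj2 HY), Hz.
    - intros C Y Hne HC HQ HY.
      destruct (classic (exists X, X ∈ C /\ subset X c')) as [[X [HX K]]|N].
      + right; intros z Hz; apply K; exact (proj1 (proj2 HY z) Hz X HX).
      + left; intros z Hz; apply (proj2 HY); intros X HX.
        destruct (HQ X HX) as [K|K]; [exact (K z Hz)|].
        exfalso; eauto. }
  assert (all_extreme : forall c, c ∈ F -> extreme c).
  { apply (ind extreme).
    - unfold extreme; define.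
    - intros X Y HX HTX NXT; exfalso; apply NXT.
      apply (extensionality ZFA); [apply (HF X HX)|exact Tset|].
      intro z; split; [apply (HF X HX)|apply HTX].
    - intros c c' Hc Ec Hc' X Y HX HcX NX HY.
      destruct (dichotomy c Hc Ec c' Hc' X HX) as [K|K].
      + destruct (classic (X = c)) as [->|NXc].
        * intros z Hz; apply (proj2 HY), (proj2 Hc'), Hz.
        * intros z Hz; apply (Ec X Y HX K NXc HY), (proj2 Hc'), Hz.
      + exfalso; apply NX; apply (extensionality ZFA).
        * apply (HF X HX).
        * apply Hc'.
        * intro z; split; auto.
    - intros C d Hne HC EC Hd X Y HX HdX NX HY.
      assert (exists c, c ∈ C /\ ~ subset X c) as [c [Hc NXc]].
      { apply NNPP; intro N; apply NX; apply (extensionality ZFA).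
        - apply (HF X HX).
        - apply Hd.
        - intro z; split; [|apply HdX]; intro Hz.
          apply (proj2 Hd); intros c Hc; apply NNPP; intro Nz.
          apply N; exists c; split; [exact Hc|]; intro K; apply Nz, K, Hz. }
      destruct (part_exists c) as [c' Hc'].
      destruct (dichotomy c (HC c Hc) (EC c Hc) c' Hc' X HX) as [K|K].
      + intros z Hz; apply (EC c Hc X Y HX K); [|exact HY|].
        * intros ->; apply NXc; intro; auto.
        * exact (proj1 (proj2 Hd z) Hz c Hc).
      + exfalso; apply NXc; intros z Hz; apply (proj2 Hc'), K, Hz. }
  assert (chain : forall X Z, X ∈ F -> Z ∈ F -> subset X Z \/ subset Z X).
  { intros X Z HX HZ; destruct (part_exists X) as [X' HX'].
    destruct (dichotomy X HX (all_extreme X HX) X' HX' Z HZ) as [K|K]; auto.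
    right; intros z Hz; apply (proj2 HX'), K, Hz. }
  assert (good : forall X, X ∈ F -> Good X).
  { apply ind; auto.
    - intros X Y _; apply GS.
    - intros C Y Hne HC; intros; apply (GI C Y); auto. }
  destruct (@intersection_exists F) as [X HX]; [eauto|].
  assert (FX : X ∈ F).
  { apply (FI F X); eauto; intro; auto. }
  exists X; split; [apply HX|split; [exact (good X FX)|]].
  destruct (part_exists X) as [Y HY]; intros x Hx.
  exact (proj2 (proj1 (proj2 HY x)
    (proj1 (proj2 HX x) Hx Y (FS X Y FX HY)))).
Qed.

End FixedPoint.

(** * Trees and their levels *)

Section Trees.

Context {M : structure} (ZFA : models_ZFA M).

Lemma ordinal_member (a b : M) :
  is_ordinal a -> b ∈ a -> is_ordinal b.
Proof.
  intros [_ [Hsub [Htr [Hirr [Htri Hwf]]]]] Hb.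
  destruct (Hsub b Hb) as [Sb K]; split; [exact Sb|repeat split].
  - apply (Hsub x); auto.
  - intros z Hz; apply (Htr z x b); auto; apply (Hsub x); auto.
  - intros x y z Hx Hy Hz; apply Htr; auto.
  - intros x Hx; apply Hirr; auto.
  - intros x y Hx Hy; apply Htri; auto.
  - intros c Hc; apply Hwf; intros z Hz; auto.
Qed.

Definition below (le x y : M) : Prop := related le x y /\ x <> y.

(** Well-ordering of the predecessors of [x], restated for predicates. *)
Lemma tree_minimal (T le : M) (P : M -> Prop) (x : M) :
  is_tree T le -> definable1 P -> x ∈ T -> P x ->
  exists m, related le m x /\ P m /\ forall y, P y -> related le y m -> y = m.
Proof.
  intros [[_ [_ [Hle [Hrefl [Hanti Htrans]]]]] [_ Hwf]] HP Hx Px.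
  destruct (separation ZFA T (P := fun y => related le y x /\ P y))
    as [b [_ Hb]]; [define|].
  destruct (proj2 (Hwf x Hx) b) as [m [Hm K]].
  - exists x; apply Hb; auto.
  - intros y Hy; apply Hb, Hy.
  - apply Hb in Hm; destruct Hm as [Hm [Hmx Pm]].
    exists m; split; [exact Hmx|split; [exact Pm|]].
    intros y Py Hym; apply Hanti; [exact Hym|]; apply K, Hb.
    split; [|split; [exact (Htrans _ _ _ Hym Hmx)|exact Py]].
    destruct Hym as [p [Hp Kp]]; destruct (Hle p Kp) as [y' [m' [Hy [_ Hp']]]].
    destruct (opair_injective ZFA Hp Hp') as [-> _]; exact Hy.
Qed.

(** The recursion equations of the level sequence, with the sequence replaced by
    the relation [lv b x] (the vertex [x] has level [b]) and its domain by a
    transitive set [d] of transitive sets.  A relation is easier to restrict and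
    to compare than a function whose values are sets. *)
Definition levelling (T le d : M) (lv : M -> M -> Prop) : Prop :=
  definable2 lv /\
  (forall b, b ∈ d -> is_set b /\ forall c, c ∈ b -> c ∈ d /\ subset c b) /\
  (forall b x, lv b x -> b ∈ d) /\
  (forall b x, b ∈ d -> (lv b x <->
     minimal le (fun y => y ∈ T /\ ~ exists c, c ∈ b /\ lv c y) x)).

Lemma levelling_of_level (T le a L : M) :
  is_level T le a L ->
  exists d lv, is_succ d a /\ levelling T le d lv /\
    is_set L /\ forall x, x ∈ L <-> lv a x.
Proof.
  intros [[Ha [Hsub [Htr _]]] [d [f [Hd [Ff [Hf HL]]]]]].
  exists d, (fun b x => exists X, related f b X /\ x ∈ X).
  split; [exact Hd|split; [split; [define|split; [|split]]|split]].
  - intros b Hb; apply (proj2 Hd) in Hb; destruct Hb as [Hb | ->].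
    + destruct (Hsub b Hb) as [Hsb K]; split; [exact Hsb|].
      intros c Hc; split; [apply (proj2 Hd); auto|].
      intros z Hz; apply (Htr z c b); auto; apply (Hsub c (K c Hc)), Hz.
    + split; [exact Ha|]; intros c Hc; split; [apply (proj2 Hd); auto|].
      apply (Hsub c Hc).
  - intros b x [X [HX _]]; exact (related_domain ZFA Ff HX).
  - intros b x Hb; destruct (proj2 (proj2 Ff) b Hb) as [X [HX U]].
    transitivity (x ∈ X).
    { split; [intros [X' [HX' Hx]]; rewrite (U X' HX'); exact Hx|eauto]. }
    rewrite (proj2 (Hf b X HX)).
    assert (E : forall y,
      (y ∈ T /\ ~ exists c Y, c ∈ b /\ related f c Y /\ y ∈ Y) <->
      (y ∈ T /\ ~ exists c, c ∈ b /\ exists X, related f c X /\ y ∈ X)).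
    { intro y; split; intros [Hy N]; split; auto; intro K; apply N.
      - destruct K as [c [Hc [Y [HY K]]]]; exists c, Y; auto.
      - destruct K as [c [Y [Hc [HY K]]]]; exists c; eauto. }
    unfold minimal; rewrite E; split; intros [Hx K]; split; auto;
      intros y Hy; apply K, E, Hy.
  - apply (Hf a L HL).
  - intro x; split; [eauto|]; intros [X [HX Hx]].
    rewrite (function_unique ZFA Ff HL HX); exact Hx.
Qed.

Lemma level_of_levelling (T le d a L : M) (lv : M -> M -> Prop) :
  is_ordinal a -> is_succ d a -> levelling T le d lv ->
  is_set L -> (forall x, x ∈ L <-> lv a x) -> is_level T le a L.
Proof.
  intros Ha Hd [Dlv [_ [Hdom Hlv]]] HL KL.
  assert (Hsets : forall b, b ∈ d -> exists! X,
    is_set X /\ forall x, x ∈ X <-> lv b x).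
  { intros b Hb.
    destruct (separation ZFA T (P := lv b)) as [X [HX KX]]; [define|].
    assert (E : forall x, x ∈ X <-> lv b x).
    { intro x; rewrite KX; split; [tauto|]; intro K; split; [|exact K].
      apply (Hlv b x Hb) in K; apply K. }
    exists X; split; [auto|]; intros X' [HX' KX'].
    apply (extensionality ZFA); auto; intro z; rewrite E, KX'; reflexivity. }
  split; [exact Ha|].
  destruct (function_of_relation ZFA
    (R := fun b X => is_set X /\ forall x, x ∈ X <-> lv b x) (d := d))
    as [f [Ff Kf]]; [define|exact Hsets|].
  exists d, f; split; [exact Hd|split; [exact Ff|split]].
  - intros b X HX; apply Kf in HX; destruct HX as [Hb [HX KX]].
    split; [exact HX|]; intro x; rewrite KX, (Hlv b x Hb).
    assert (E : forall y,
      (y ∈ T /\ ~ exists c, c ∈ b /\ lv c y) <->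
      (y ∈ T /\ ~ exists c Y, c ∈ b /\ related f c Y /\ y ∈ Y)).
    { intro y; split; intros [Hy N]; split; auto; intro K; apply N.
      - destruct K as [c [Y [Hc [HY K]]]]; apply Kf in HY.
        exists c; split; [exact Hc|]; apply HY; exact K.
      - destruct K as [c [Hc K]]; pose proof (Hdom c y K) as Hcd.
        destruct (Hsets c Hcd) as [Y [HY _]].
        exists c, Y; split; [exact Hc|split]; [apply Kf; auto|].
        apply HY; exact K. }
    unfold minimal; rewrite E; split; intros [Hx K]; split; auto;
      intros y Hy; apply K, E, Hy.
  - apply Kf; split; [apply (proj2 Hd); auto|auto].
Qed.

Lemma levelling_initial (T le d n n' : M) (lv : M -> M -> Prop) :
  levelling T le d lv -> n ∈ d -> is_succ n' n ->
  levelling T le n' (fun b x => b ∈ n' /\ lv b x).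
Proof.
  intros [Dlv [L1 [L2 L3]]] Hn Hn'; destruct (L1 n Hn) as [_ Kn].
  assert (Hsub : forall b, b ∈ n' -> b ∈ d).
  { intros b Hb; apply (proj2 Hn') in Hb; destruct Hb as [Hb | ->]; auto.
    apply (Kn b Hb). }
  assert (Hin : forall b c, b ∈ n' -> c ∈ b -> c ∈ n').
  { intros b c Hb Hc; apply (proj2 Hn') in Hb; apply (proj2 Hn'); left.
    destruct Hb as [Hb | ->]; [exact (proj2 (Kn b Hb) c Hc)|exact Hc]. }
  split; [define|split; [|split]].
  - intros b Hb; destruct (L1 b (Hsub b Hb)) as [Sb Kb]; split; [exact Sb|].
    intros c Hc; split; [eauto|apply Kb, Hc].
  - tauto.
  - intros b x Hb; rewrite (L3 b x (Hsub b Hb)).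
    assert (F : forall y,
      (y ∈ T /\ ~ exists c, c ∈ b /\ c ∈ n' /\ lv c y) <->
      (y ∈ T /\ ~ exists c, c ∈ b /\ lv c y)).
    { intro y; split; intros [Hy N]; split; auto; intros [c [Hc K]];
        apply N; exists c; [eauto|tauto]. }
    unfold minimal; rewrite F; split.
    + intros [_ [Hx K]]; split; [exact Hx|]; intros y Hy; apply K, F, Hy.
    + intros [Hx K]; split; [exact Hb|split; [exact Hx|]].
      intros y Hy; apply K, F, Hy.
Qed.

(** If [c < b], then [x] itself is still present when level [c] is formed, so
    some vertex below [x] is minimal there; and the minimality of [x] at stage [b]
    says that all vertices below [x] have been used up before. *)
Lemma levelling_predecessors (T le d : M) (lv : M -> M -> Prop) (b x : M) :
  is_tree T le -> levelling T le d lv -> lv b x ->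
  x ∈ T /\ is_set b /\ (forall c, c ∈ b -> exists y, below le y x /\ lv c y) /\
  (forall y, below le y x -> exists c, c ∈ b /\ lv c y).
Proof.
  intros Ht [Dlv [Hd [Hdom Hlv]]] Hx.
  pose proof (Hdom b x Hx) as Hb; pose proof Ht as
    [[_ [_ [Hle [Hrefl [Hanti Htrans]]]]] _].
  destruct (proj1 (Hlv b x Hb) Hx) as [[HxT Nx] Kx].
  split; [exact HxT|split; [apply (Hd b Hb)|split]].
  - intros c Hc; destruct (proj2 (Hd b Hb) c Hc) as [Hcd Hcb].
    destruct (tree_minimal (P := fun y => y ∈ T /\ ~ exists c', c' ∈ c /\ lv c' y)
      (x := x) Ht) as [m [Hmx [Pm Km]]]; auto.
    + define.
    + split; [exact HxT|]; intros [c' [Hc' K]]; apply Nx; eauto.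
    + assert (Hm : lv c m) by (apply (Hlv c m Hcd); split; auto).
      exists m; split; [split; [exact Hmx|]|exact Hm].
      intros ->; apply Nx; eauto.
  - intros y [[p [Hp Kp]] Nyx]; destruct (Hle p Kp) as [y' [x' [Hy [_ Hp']]]].
    destruct (opair_injective ZFA Hp Hp') as [<- _].
    apply NNPP; intro N; apply Nyx, Kx; auto; exists p; auto.
Qed.

(** By induction on [x]: both [b] and [b'] are the set of the levels of the
    vertices below [x], so they are equal by extensionality. *)
Lemma levelling_unique (T le d d' : M) (lv lv' : M -> M -> Prop) (b b' x : M) :
  is_tree T le -> levelling T le d lv -> levelling T le d' lv' ->
  lv b x -> lv' b' x -> b = b'.
Proof.
  intros Ht Hl Hl' Hb Hb'; apply NNPP; intro N.
  pose proof Hl as [Dlv _]; pose proof Hl' as [Dlv' _].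
  destruct (tree_minimal
    (P := fun x => exists b b', lv b x /\ lv' b' x /\ b <> b') (x := x) Ht)
    as [m [_ [[a [a' [Ha [Ha' Na]]]] Hm]]].
  - define.
  - apply (levelling_predecessors Ht Hl Hb).
  - eauto.
  - apply Na; destruct (levelling_predecessors Ht Hl Ha) as [_ [Sa [A1 A2]]].
    destruct (levelling_predecessors Ht Hl' Ha') as [_ [Sa' [A1' A2']]].
    assert (IH : forall y c c', below le y m -> lv c y -> lv' c' y -> c = c').
    { intros y c c' [Hy Ny] Hc Hc'; apply NNPP; intro K; apply Ny, Hm; eauto 6. }
    apply (extensionality ZFA); auto; intro c; split; intro Hc.
    + destruct (A1 c Hc) as [y [Hy Ky]], (A2' y Hy) as [c' [Hc' Ky']].
      rewrite (IH y c c' Hy Ky Ky'); exact Hc'.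
    + destruct (A1' c Hc) as [y [Hy Ky]], (A2 y Hy) as [c' [Hc' Ky']].
      rewrite <- (IH y c' c Hy Ky' Ky); exact Hc'.
Qed.
End Trees.

(** * Pruning a tree with finite levels *)

Section FiniteLevels.

Context {M : structure} (ZFA : models_ZFA M).
Context {omega T le d : M} {lv : M -> M -> Prop}.
Context (Homega : is_omega omega) (Hord : is_ordinal omega).
Context (Htree : is_tree T le) (Hd : is_succ d omega).
Context (Hlv : levelling T le d lv).
Context (Htop : forall x, ~ lv omega x).
Context (Hinhabited : forall n, n ∈ omega -> exists x, lv n x).
Context (Hfinite : forall n, n ∈ omega ->
  exists L, is_set L /\ finite L /\ forall x, x ∈ L <-> lv n x).

(* Kept in the context, where [define] looks for it. *)
Let Dlv : definable2 lv := proj1 Hlv.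

Lemma omega_asymmetric (m n : M) : m ∈ omega -> n ∈ omega -> m ∈ n -> ~ n ∈ m.
Proof.
  intros Hm Hn H K; exact (not_self_member ZFA
    (proj1 (proj2 (proj2 Hord)) m n m Hm Hn Hm H K)).
Qed.

Lemma omega_trichotomy (m n : M) :
  m ∈ omega -> n ∈ omega -> m ∈ n \/ m = n \/ n ∈ m.
Proof. apply Hord. Qed.

Definition least (P : M -> Prop) (n : M) : Prop :=
  P n /\ forall m, P m -> n = m \/ n ∈ m.

(** Numbers of successors and indices of levels are compared as elements of
    [omega], so minima exist without any arithmetic of cardinals. *)
Lemma least_exists (P : M -> Prop) (n : M) :
  definable1 P -> (forall m, P m -> m ∈ omega) -> P n -> exists m, least P m.
Proof.
  intros HP Ho Hn; destruct (separation ZFA omega HP) as [b [_ Hb]].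
  destruct Hord as [_ [_ [_ [_ [_ Hwf]]]]].
  destruct (Hwf b) as [m [Hm K]].
  - intros z Hz; apply Hb, Hz.
  - exists n; apply Hb; auto.
  - exists m; split; [apply Hb, Hm|]; intros k Hk; apply K, Hb; auto.
Qed.

Lemma least_unique (P : M -> Prop) (m n : M) :
  (forall k, P k -> k ∈ omega) -> least P m -> least P n -> m = n.
Proof.
  intros Ho [Pm Lm] [Pn Ln].
  destruct (Lm n Pn) as [->|H]; [reflexivity|].
  destruct (Ln m Pm) as [->|K]; [reflexivity|].
  exfalso; exact (omega_asymmetric (Ho m Pm) (Ho n Pn) H K).
Qed.

Lemma le_refl (x : M) : x ∈ T -> related le x x.
Proof. apply Htree. Qed.

Lemma le_trans (x y z : M) : related le x y -> related le y z -> related le x z.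
Proof. apply Htree. Qed.

Lemma le_antisym (x y : M) : related le x y -> related le y x -> x = y.
Proof. apply Htree. Qed.

Lemma le_comparable (x y z : M) :
  z ∈ T -> related le x z -> related le y z -> related le x y \/ related le y x.
Proof. intro Hz; apply (proj2 (proj2 Htree) z Hz). Qed.

Lemma le_field (x y : M) : related le x y -> x ∈ T /\ y ∈ T.
Proof.
  intros [p [Hp K]]; destruct Htree as [[_ [_ [Hle _]]] _].
  destruct (Hle p K) as [x' [y' [Hx [Hy Hp']]]].
  destruct (opair_injective ZFA Hp Hp') as [-> ->]; auto.
Qed.

Lemma lv_omega (n x : M) : lv n x -> n ∈ omega.
Proof.
  intro H; pose proof (proj1 (proj2 (proj2 Hlv)) n x H) as K.
  apply (proj2 Hd) in K; destruct K as [K| ->]; [exact K|].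
  destruct (Htop H).
Qed.

Lemma lv_T (n x : M) : lv n x -> x ∈ T.
Proof. intro H; apply (levelling_predecessors ZFA Htree Hlv H). Qed.

Lemma lv_unique (m n x : M) : lv m x -> lv n x -> m = n.
Proof. exact (levelling_unique ZFA Htree Hlv Hlv). Qed.

Lemma lv_lower (m n x : M) :
  lv n x -> m ∈ n -> exists y, below le y x /\ lv m y.
Proof. intro H; apply (levelling_predecessors ZFA Htree Hlv H). Qed.

Lemma lv_lt (m n x y : M) : lv m x -> lv n y -> below le x y -> m ∈ n.
Proof.
  intros Hx Hy Hxy.
  destruct (levelling_predecessors ZFA Htree Hlv Hy) as [_ [_ [_ H]]].
  destruct (H x Hxy) as [c [Hc Hx']]; rewrite (lv_unique Hx Hx'); exact Hc.
Qed.

(** A vertex outside all levels below [omega] would make level [omega]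
    inhabited. *)
Lemma lv_cover (x : M) : x ∈ T -> exists n, lv n x.
Proof.
  intro Hx; apply NNPP; intro N.
  destruct (tree_minimal ZFA
    (P := fun y => y ∈ T /\ ~ exists c, c ∈ omega /\ lv c y) (x := x) Htree)
    as [m [_ [Hm K]]]; auto.
  - define.
  - split; [exact Hx|]; intros [c [_ Hc]]; eauto.
  - apply (Htop (x := m)), Hlv; [apply (proj2 Hd); auto|split; auto].
Qed.

Lemma lv_antichain (n x y : M) : lv n x -> lv n y -> related le x y -> x = y.
Proof.
  intros Hx Hy H; apply NNPP; intro N.
  exact (not_self_member ZFA (lv_lt Hx Hy (conj H N))).
Qed.

Lemma lv_next (n n' x y : M) :
  lv n x -> is_succ n' n -> below le x y ->
  exists z, lv n' z /\ below le x z /\ related le z y.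
Proof.
  intros Hx Hn' Hxy; destruct (le_field (proj1 Hxy)) as [_ HyT].
  destruct (lv_cover HyT) as [m Hy]; pose proof (lv_lt Hx Hy Hxy) as Hnm.
  pose proof (lv_omega Hx) as Hn; pose proof (lv_omega Hy) as Hm.
  assert (Hn'o : n' ∈ omega).
  { destruct (proj2 (omega_inductive ZFA Homega) n Hn) as [k [Hk Ko]].
    rewrite (succ_unique ZFA Hn' Hk); exact Ko. }
  assert (Hnn' : n ∈ n') by (apply (proj2 Hn'); auto).
  destruct (omega_trichotomy Hn'o Hm) as [H|[->|H]].
  - destruct (lv_lower Hy H) as [z [[Hzy _] Hz]]; exists z.
    split; [exact Hz|split; [|exact Hzy]].
    assert (Nxz : x <> z).
    { intros ->; pose proof (lv_unique Hx Hz) as E; rewrite <- E in Hnn'.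
      exact (not_self_member ZFA Hnn'). }
    destruct (le_comparable HyT (proj1 Hxy) Hzy) as [K|K]; [split; auto|].
    exfalso; apply (omega_asymmetric Hn Hn'o Hnn').
    apply (lv_lt Hz Hx); split; auto.
  - exists y; split; [exact Hy|split; [exact Hxy|apply le_refl; exact HyT]].
  - exfalso; apply (proj2 Hn') in H; destruct H as [H | ->].
    + exact (omega_asymmetric Hn Hm Hnm H).
    + exact (not_self_member ZFA Hnm).
Qed.

Lemma omega_zero : exists e, is_empty e /\ e ∈ omega.
Proof. apply (omega_inductive ZFA Homega). Qed.

Definition downclosed (X : M) : Prop :=
  subset X T /\ forall x y, x ∈ X -> related le y x -> y ∈ X.

Definition good (X : M) : Prop :=
  is_set X /\ downclosed X /\ forall n, n ∈ omega -> exists x, x ∈ X /\ lv n x.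

Lemma succ_set_exists (X x : M) : exists s, is_succ_set X le s x.
Proof.
  destruct (separation ZFA X (P := immediate_succ X le x)) as [s [Hs K]].
  { define. }
  exists s; split; [exact Hs|]; intro y; rewrite K; split; [tauto|].
  intro H; split; [apply H|exact H].
Qed.

Lemma succ_set_unique (X x s t : M) :
  is_succ_set X le s x -> is_succ_set X le t x -> s = t.
Proof.
  intros [Hs Ks] [Ht Kt]; apply (extensionality ZFA); auto.
  intro z; rewrite Ks, Kt; reflexivity.
Qed.

(** All immediate successors lie in the next level, by [lv_next]. *)
Lemma succ_set_finite (X x s n : M) :
  subset X T -> lv n x -> is_succ_set X le s x -> finite s.
Proof.
  intros HX Hx [Hs Ks].
  destruct (proj2 (omega_inductive ZFA Homega) n (lv_omega Hx))
    as [n' [Hn' Hn'o]].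
  destruct (Hfinite Hn'o) as [L [HL [FL KL]]].
  apply (finite_subset ZFA Homega HL FL Hs).
  intros y Hy; apply Ks in Hy; destruct Hy as [_ [Nyx [Hxy Hmin]]].
  destruct (lv_next Hx Hn' (conj Hxy (not_eq_sym Nyx))) as [z [Hz [[Hxz Nxz] Hzy]]].
  apply KL; destruct (Hmin z Hxz Hzy) as [->| ->]; [congruence|exact Hz].
Qed.

Lemma leafless_levels (X x0 : M) :
  downclosed X -> x0 ∈ X -> (forall x, ~ is_leaf X le x) ->
  forall n, n ∈ omega -> exists x, x ∈ X /\ lv n x.
Proof.
  intros [HXT HX] Hx0 Hleaf.
  apply (omega_induction ZFA Homega); [define| |].
  - intros e He; destruct (lv_cover (HXT x0 Hx0)) as [m Hm].
    assert (Heo : e ∈ omega).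
    { destruct omega_zero as [e' [He' Ke']].
      rewrite (empty_unique ZFA He He'); exact Ke'. }
    destruct (omega_trichotomy Heo (lv_omega Hm)) as [H|[->|H]].
    + destruct (lv_lower Hm H) as [y [[Hy _] Ky]]; eauto.
    + eauto.
    + destruct (proj2 He m H).
  - intros n n' Hn [x [Hx Kx]] Hn'.
    assert (exists y, y ∈ X /\ below le x y) as [y [Hy Hxy]].
    { apply NNPP; intro N; apply (Hleaf x); split; [exact Hx|].
      intros y Hy Hxy; apply NNPP; intro K; apply N; exists y.
      split; [exact Hy|split; auto]. }
    destruct (lv_next Kx Hn' Hxy) as [z [Hz [_ Hzy]]]; eauto.
Qed.

Definition unbalanced (X n : M) : Prop :=
  exists x y s t, x ∈ X /\ y ∈ X /\ lv n x /\ lv n y /\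
    is_succ_set X le s x /\ is_succ_set X le t y /\ ~ equinumerous s t.

Definition branches (X n k a : M) : Prop :=
  a ∈ X /\ lv n a /\ exists s, is_succ_set X le s a /\ equinumerous s k.

(** The vertices with the fewest successors on the lowest unbalanced level. *)
Definition pivot (X a : M) : Prop :=
  exists n k, least (unbalanced X) n /\
    least (fun k => k ∈ omega /\ exists a, branches X n k a) k /\
    branches X n k a.

(** Removal of leaves has priority: the part about pivots asks for nothing as long
    as [X] has a leaf. *)
Definition step (X x : M) : Prop :=
  ~ is_leaf X le x /\
  ((forall y, ~ is_leaf X le y) -> (exists n, unbalanced X n) ->
   exists a, pivot X a /\ (related le x a \/ related le a x)).

Ltac unfold_more ::= unfold adjoin, is_part, is_intersection, below, least,
  downclosed, good, unbalanced, branches, pivot, step.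

Lemma unbalanced_omega (X n : M) : unbalanced X n -> n ∈ omega.
Proof. intros [x [_ [_ [_ [_ [_ [H _]]]]]]]; exact (lv_omega H). Qed.

Lemma level_has_branches (X n x : M) :
  subset X T -> x ∈ X -> lv n x -> exists k, k ∈ omega /\ branches X n k x.
Proof.
  intros HX Hx Kx; destruct (succ_set_exists X x) as [s Hs].
  destruct (succ_set_finite HX Kx Hs) as [w [k [Hw [Hk K]]]].
  exists k; split; [apply (proj2 Homega), (proj2 Hw), Hk|].
  split; [exact Hx|split; [exact Kx|eauto]].
Qed.

Lemma pivot_exists (X n : M) :
  subset X T -> unbalanced X n -> exists a, pivot X a.
Proof.
  intros HX Hn.
  destruct (@least_exists (unbalanced X) n) as [m Hm];
    [define|apply unbalanced_omega|exact Hn|].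
  pose proof (proj1 Hm) as [x [_ [_ [_ [Hx [_ [Kx _]]]]]]].
  destruct (level_has_branches HX Hx Kx) as [k [Hk Kk]].
  destruct (@least_exists (fun k => k ∈ omega /\ exists a, branches X m k a) k)
    as [j Hj]; [define|tauto|eauto|].
  pose proof (proj1 Hj) as [_ [a Ha]]; exists a, m, j; auto.
Qed.

Lemma not_leaf (X x : M) :
  x ∈ X -> ~ is_leaf X le x -> exists y, y ∈ X /\ below le x y.
Proof.
  intros Hx H; apply NNPP; intro N; apply H; split; [exact Hx|].
  intros y Hy Hxy; apply NNPP; intro K; apply N; exists y.
  split; [exact Hy|split; auto].
Qed.

(** Removing the leaves removes no vertex that has one above it, and level [n + 1]
    supplies such vertices on level [n].  In the other case [X] has no leaves, and
    the set kept has none either: above a pivot everything is kept, and below one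
    there is the pivot.  A leafless set meets all levels. *)
Lemma good_step (X Y : M) : good X -> is_part (step X) Y X -> good Y.
Proof.
  intros [HX [[HXT HXd] HXn]] [HY KY]; split; [exact HY|].
  assert (HYT : subset Y T) by (intros z Hz; apply HXT, KY, Hz).
  assert (Dinner : forall x y, x ∈ X -> ~ is_leaf X le x -> related le y x ->
    ~ is_leaf X le y).
  { intros x y Hx Nx Hyx [_ Hy]; apply Nx; rewrite <- (Hy x Hx Hyx) in Hy.
    split; [exact Hx|]; intros z Hz Hxz.
    exact (Hy z Hz Hxz). }
  assert (HYd : downclosed Y).
  { split; [exact HYT|]; intros x y Hx Hyx; apply KY in Hx.
    destruct Hx as [Hx [Nx Sx]].
    apply KY; split; [exact (HXd x y Hx Hyx)|split].
    - exact (Dinner x y Hx Nx Hyx).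
    - intros Nl Hu; destruct (Sx Nl Hu) as [a [Ha Hxa]].
      exists a; split; [exact Ha|]; destruct Hxa as [Hxa|Hax].
      + left; exact (le_trans Hyx Hxa).
      + exact (le_comparable (HXT x Hx) Hyx Hax). }
  split; [exact HYd|].
  destruct (classic (exists l, is_leaf X le l)) as [[l Hl]|Nl].
  - intros n Hn.
    destruct (proj2 (omega_inductive ZFA Homega) n Hn) as [n' [Hn' Hn'o]].
    destruct (HXn n' Hn'o) as [x [Hx Kx]].
    destruct (lv_lower Kx (m := n)) as [y [[Hyx Nyx] Hy]].
    { apply (proj2 Hn'); auto. }
    exists y; split; [|exact Hy]; apply KY; split; [exact (HXd x y Hx Hyx)|split].
    + intros [_ K]; apply Nyx; symmetry; exact (K x Hx Hyx).
    + intro K; destruct (K l Hl).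
  - assert (Nl' : forall l, ~ is_leaf X le l) by (intros l Hl; eauto).
    assert (SY : forall x, x ∈ Y <-> x ∈ X /\ ((exists n, unbalanced X n) ->
      exists a, pivot X a /\ (related le x a \/ related le a x))).
    { intro x; rewrite KY; unfold step; split; intros [Hx K].
      - split; [exact Hx|apply K, Nl'].
      - split; [exact Hx|split; auto]. }
    assert (PY : forall a, pivot X a -> a ∈ Y).
    { intros a Ha; assert (a ∈ X) by (destruct Ha as [? [? [_ [_ [K _]]]]]; auto).
      apply SY; split; [auto|]; intros _; exists a; split; [exact Ha|left].
      apply le_refl; auto. }
    assert (exists x0, x0 ∈ Y) as [x0 Hx0].
    { destruct (classic (exists n, unbalanced X n)) as [[n Hn]|N].
      - destruct (pivot_exists HXT Hn) as [a Ha]; eauto.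
      - destruct omega_zero as [e [_ He]]; destruct (HXn e He) as [x [Hx _]].
        exists x; apply SY; split; [exact Hx|tauto]. }
    apply (leafless_levels HYd Hx0); intros x [Hx Kx].
    pose proof (proj1 (SY x) Hx) as [HxX Sx].
    destruct (not_leaf HxX (Nl' x)) as [y [Hy [Hxy Nxy]]].
    assert (up : forall z, z ∈ Y -> related le x z -> x <> z -> False).
    { intros z Hz Hxz N; apply N; symmetry; exact (Kx z Hz Hxz). }
    destruct (classic (exists n, unbalanced X n)) as [Hu|Nu].
    + destruct (Sx Hu) as [a [Ha [Hxa|Hax]]].
      * destruct (classic (x = a)) as [->|Nxa]; [|exact (up a (PY a Ha) Hxa Nxa)].
        apply (up y); auto; apply SY; split; eauto.
      * apply (up y); auto; apply SY; split; [exact Hy|]; intros _.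
        exists a; split; [exact Ha|right; exact (le_trans Hax Hxy)].
    + apply (up y); auto; apply SY; split; [exact Hy|tauto].
Qed.

Lemma step_fixpoint (X : M) :
  subset X T -> (forall x, x ∈ X -> step X x) ->
  (forall x, ~ is_leaf X le x) /\ forall n, ~ unbalanced X n.
Proof.
  intros HXT H.
  assert (Nl : forall x, ~ is_leaf X le x).
  { intros x Hx; exact (proj1 (H x (proj1 Hx)) Hx). }
  split; [exact Nl|]; intros m0 Hm0.
  destruct (@least_exists (unbalanced X) m0) as [n Hn];
    [define|apply unbalanced_omega|exact Hm0|].
  destruct (@pivot_exists X m0 HXT Hm0) as [a0 [n0 [k [Hn0 [Hk _]]]]].
  rewrite <- (least_unique (@unbalanced_omega X) Hn Hn0) in Hk; clear n0 Hn0.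
  (* A vertex of level [n] is comparable to some pivot, which lies in the same
     level; so it is that pivot. *)
  assert (K : forall x s, x ∈ X -> lv n x -> is_succ_set X le s x ->
    equinumerous s k).
  { intros x s Hx Kx Hs.
    destruct (proj2 (H x Hx) Nl) as [a [[n1 [k1 [Hn1 [Hk1 Ha]]]] Hxa]]; [eauto|].
    rewrite <- (least_unique (@unbalanced_omega X) Hn Hn1) in Hk1, Ha.
    rewrite <- (least_unique (fun j Hj => proj1 Hj) Hk Hk1) in Ha.
    destruct Ha as [_ [Ka [t [Ht Et]]]].
    assert (x = a) as <-.
    { destruct Hxa as [L|L]; [|symmetry]; eapply lv_antichain; eauto. }
    rewrite (succ_set_unique Hs Ht); exact Et. }
  destruct (proj1 Hn) as [x [y [s [t [Hx [Hy [Kx [Ky [Hs [Ht N]]]]]]]]]].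
  apply N, (equinumerous_trans ZFA (K x s Hx Kx Hs)).
  apply (equinumerous_sym ZFA), (K y t Hy Ky Ht).
Qed.

Lemma good_intersection (C Y : M) :
  (exists X, X ∈ C) -> (forall X, X ∈ C -> good X) ->
  (forall X Z, X ∈ C -> Z ∈ C -> subset X Z \/ subset Z X) ->
  is_intersection Y C -> good Y.
Proof.
  intros Hne HC Hchain [HY KY]; split; [exact HY|split; [split|]].
  - intros z Hz; destruct Hne as [X HX]; apply (HC X HX).
    exact (proj1 (KY z) Hz X HX).
  - intros x y Hx Hyx; apply KY; intros X HX.
    apply (proj2 (proj1 (proj2 (HC X HX))) x y); [|exact Hyx].
    exact (proj1 (KY x) Hx X HX).
  - intros n Hn; destruct (Hfinite Hn) as [L [HL [FL KL]]].
    destruct (chain_meets_finite ZFA Homega HL FL Hne Hchain) as [x [Hx Kx]].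
    + intros X HX; destruct (proj2 (proj2 (HC X HX)) n Hn) as [x [Hx Kx]].
      exists x; rewrite KL; auto.
    + exists x; split; [apply KY; exact Kx|apply KL; exact Hx].
Qed.

Lemma balanced_subset_exists : exists X, good X /\
  (forall x, ~ is_leaf X le x) /\ forall n, ~ unbalanced X n.
Proof.
  assert (HT : is_set T) by apply Htree.
  destruct (deflationary_fixpoint ZFA (T := T) (step := step) HT)
    with (Good := good) as [X [_ [HX K]]].
  - define.
  - define.
  - split; [exact HT|split; [split|]].
    + intro z; auto.
    + intros x y _ H; apply (le_field H).
    + intros n Hn; destruct (Hinhabited Hn) as [x Hx]; exists x.
      split; [exact (lv_T Hx)|exact Hx].
  - exact good_step.
  - exact good_intersection.
  - exists X; split; [exact HX|]; apply step_fixpoint; [apply HX|exact K].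
Qed.

(** The fixed point with the induced order.  Its levels are the traces of those of
    [T], and successors computed in it or with the order of [T] agree, because it
    is downward closed. *)
Lemma balanced_subtree_exists : exists S leS : M,
  is_subtree S leS T le /\ balanced S leS /\
  (forall x, ~ is_leaf S leS x) /\ has_levels S leS omega.
Proof.
  destruct balanced_subset_exists as [S [[HS [[HST HSd] HSn]] [Hleaf Hbal]]].
  destruct (separation ZFA le
    (P := fun p => exists x y, x ∈ S /\ y ∈ S /\ is_opair p x y))
    as [leS [HleS KleS]]; [define|].
  assert (R : forall x y, related leS x y <-> related le x y /\ x ∈ S /\ y ∈ S).
  { intros x y; destruct (opair_exists ZFA x y) as [p Hp].
    rewrite (related_pair ZFA leS Hp), (related_pair ZFA le Hp), KleS.
    split; intros [H K]; split; auto.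
    - destruct K as [x' [y' [Hx [Hy Hp']]]].
      destruct (opair_injective ZFA Hp Hp') as [-> ->]; auto.
    - destruct K; eauto. }
  assert (Hsub : is_subtree S leS T le).
  { split; [exact HS|split; [exact HST|split; [exact HSd|split]]]; auto. }
  destruct omega_zero as [e [_ He]], (HSn e He) as [x0 [Hx0 _]]; clear e He.
  assert (HtreeS : is_tree S leS).
  { split; [split; [exact HS|split; [exact HleS|split; [|split; [|split]]]]|].
    - intros p Hp; apply KleS in Hp; apply Hp.
    - intros x Hx; apply R; split; [apply le_refl|]; auto.
    - intros x y Hxy Hyx; apply R in Hxy, Hyx; apply le_antisym; tauto.
    - intros x y z Hxy Hyz; apply R in Hxy, Hyz; apply R.
      split; [apply (le_trans (y := y))|]; tauto.
    - destruct (proj1 (proj2 Htree)) as [r [Hr Kr]].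
      assert (r ∈ S) by (apply (HSd x0 r); auto).
      split; [exists r; split; [auto|]; intros x Hx; apply R; auto|].
      intros x Hx; split.
      + intros y z Hyx Hzx; apply R in Hyx, Hzx; rewrite !R.
        destruct Hyx as [Hyx [Hy _]], Hzx as [Hzx [Hz _]].
        destruct (le_comparable (HST x Hx) Hyx Hzx); auto.
      + intros b Hne Hb.
        destruct (proj2 (proj2 (proj2 Htree) x (HST x Hx)) b Hne) as [m [Hm Km]].
        { intros y Hy; apply R, Hb, Hy. }
        exists m; split; [exact Hm|]; intros y Hy; apply R.
        split; [auto|split]; apply (R _ x), Hb; auto. }
  assert (HlvS : levelling S leS d (fun b x => lv b x /\ x ∈ S)).
  { pose proof Hlv as [_ [L1 [L2 L3]]].
    split; [define|split; [exact L1|split]].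
    - intros b x [Hx _]; exact (L2 b x Hx).
    - intros b x Hb; rewrite (L3 b x Hb).
      assert (E : forall y, (y ∈ S /\ ~ exists c, c ∈ b /\ lv c y /\ y ∈ S) <->
        (y ∈ T /\ ~ exists c, c ∈ b /\ lv c y) /\ y ∈ S).
      { intro y; split.
        - intros [Hy N]; split; [split; [auto|]|auto].
          intros [c [Hc K]]; eauto.
        - intros [[_ N] Hy]; split; [auto|].
          intros [c [Hc [K _]]]; eauto. }
      unfold minimal; rewrite E; split.
      + intros [[Px Kx] Hx]; split; [auto|]; intros y Py Hyx.
        apply Kx; [apply E, Py|apply R, Hyx].
      + intros [[Px Hx] Kx]; split; [split; [exact Px|]|exact Hx].
        intros y Py Hyx; assert (Hy : y ∈ S) by (apply (HSd x y); auto).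
        apply Kx; [apply E; auto|apply R; auto]. }
  assert (Hsucc : forall s x, x ∈ S -> is_succ_set S leS s x ->
    is_succ_set S le s x).
  { intros s x Hx [Hs Ks]; split; [exact Hs|]; intro y; rewrite Ks.
    split; intros [Hy [Nyx [Hxy Hmin]]]; split; auto; split; auto; split.
    - apply R, Hxy.
    - intros z Hxz Hzy; assert (Hz : z ∈ S) by (apply (HSd y z); auto).
      apply Hmin; apply R; auto.
    - apply R; auto.
    - intros z Hxz Hzy; apply Hmin; [apply R, Hxz|apply R, Hzy]. }
  assert (Hlevel : forall a L x, is_level S leS a L -> x ∈ L -> lv a x /\ x ∈ S).
  { intros a L x HL Hx.
    destruct (levelling_of_level ZFA HL) as [d' [lv' [_ [Hlv' [_ KL]]]]].
    apply KL in Hx.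
    assert (HxS : x ∈ S) by apply (levelling_predecessors ZFA HtreeS Hlv' Hx).
    destruct (lv_cover (HST x HxS)) as [n Hn].
    rewrite (levelling_unique ZFA HtreeS Hlv' HlvS Hx (conj Hn HxS)); auto. }
  exists S, leS; split; [exact Hsub|split; [split; [exact HtreeS|split]|split]].
  - intros x s Hx Hs; destruct (lv_cover (HST x Hx)) as [n Hn].
    exact (succ_set_finite HST Hn (Hsucc s x Hx Hs)).
  - intros a L x y s t HL Hx Hy Hs Ht.
    destruct (Hlevel a L x HL Hx) as [Kx HxS], (Hlevel a L y HL Hy) as [Ky HyS].
    apply NNPP; intro N; apply (Hbal a); exists x, y, s, t; auto 10.
  - intros x [Hx Kx]; apply (Hleaf x); split; [exact Hx|].
    intros y Hy Hxy; apply Kx; [exact Hy|apply R; auto].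
  - split.
    + destruct (separation ZFA S (P := fun _ => False)) as [L [HL KL]]; [define|].
      assert (KL' : forall x, ~ x ∈ L) by (intros x Hx; apply KL in Hx; tauto).
      exists L; split; [|split; auto].
      apply (level_of_levelling ZFA Hord Hd HlvS HL).
      intro x; split; [intro Hx; destruct (KL' x Hx)|].
      intros [Hx _]; destruct (Htop Hx).
    + (* A vertex of the subtree in level [b] of [T] cannot be used up before
         stage [b], so level [b] of the subtree is inhabited. *)
      intros b L Hb HL [_ Ke].
      destruct (levelling_of_level ZFA HL) as [d' [lv' [Hd' [Hlv' [_ KL]]]]].
      destruct (HSn b Hb) as [x [Hx Kx]].
      destruct (tree_minimal ZFA (P := fun y => y ∈ S /\
        ~ exists c, c ∈ b /\ lv' c y) (x := x) HtreeS) as [m [_ [Pm Km]]]; auto.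
      * pose proof (proj1 Hlv'); define.
      * split; [exact Hx|]; intros [c [Hc Kc]].
        pose proof (levelling_unique ZFA HtreeS Hlv' HlvS Kc (conj Kx Hx)) as E.
        rewrite E in Hc; exact (not_self_member ZFA Hc).
      * apply (Ke m), KL, Hlv'; [apply (proj2 Hd'); auto|split; auto].
Qed.

End FiniteLevels.

Unset Implicit Arguments.

Theorem lemma4p1 (M : structure) (ZFA : models_ZFA M) (omega T le : M)
    (Homega : is_omega omega)
    (Htree : is_tree T le)
    (Hlevels : has_levels T le omega)
    (Hfinite : forall n L : M, n ∈ omega -> is_level T le n L -> finite L) :
  exists S leS : M,
    is_subtree S leS T le /\
    balanced S leS /\
    (forall x : M, ~ is_leaf S leS x) /\
    has_levels S leS omega.
Proof.
  destruct Hlevels as [[top [Htop Hempty]] Hnonempty].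
  pose proof (proj1 Htop) as Hord.
  destruct (levelling_of_level ZFA Htop) as [d [lv [Hd [Hlv [_ Ktop]]]]].
  assert (Hlevel : forall n, n ∈ omega -> exists L, is_set L /\
    is_level T le n L /\ forall x, x ∈ L <-> lv n x).
  { intros n Hn; pose proof (proj1 Hlv) as Dlv.
    destruct (separation ZFA T (P := lv n)) as [L [HL KL]]; [define|].
    assert (E : forall x, x ∈ L <-> lv n x).
    { intro x; rewrite KL; split; [tauto|]; intro Hx; split; [|exact Hx].
      apply (levelling_predecessors ZFA Htree Hlv Hx). }
    exists L; split; [exact HL|split; [|exact E]].
    destruct (proj2 (omega_inductive ZFA Homega) n Hn) as [n' [Hn' _]].
    apply (level_of_levelling ZFA (d := n') (lv := fun b x => b ∈ n' /\ lv b x)); auto.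
    - exact (ordinal_member Hord Hn).
    - apply (levelling_initial Hlv (n := n)); [apply (proj2 Hd); auto|exact Hn'].
    - intro x; rewrite E; split; [|tauto]; split; [apply (proj2 Hn'); auto|auto]. }
  apply (balanced_subtree_exists ZFA Homega Hord Htree Hd Hlv).
  - intros x Hx; exact (proj2 Hempty x (proj2 (Ktop x) Hx)).
  - intros n Hn; destruct (Hlevel n Hn) as [L [HL [KL E]]].
    apply NNPP; intro N; apply (Hnonempty n L Hn KL); split; [exact HL|].
    intros x Hx; apply N; exists x; apply E, Hx.
  - intros n Hn; destruct (Hlevel n Hn) as [L [HL [KL E]]].
    exists L; split; [exact HL|split; [exact (Hfinite n L Hn KL)|exact E]].
Qed.
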